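(* Let $m\in C(\mathbb T)$ satisfy the uniform Dini condition $$\sup_{t\in\mathbb T}\int_{|t-\theta|\le\varepsilon}\frac{|m(t)-m(\theta)|}{|t-\theta|}\,d\theta\to 0\qquad(\varepsilon\to+0).$$ Then $m\in MU(\mathbb T)$, and $$\|m\|_{MU(\mathbb T)}\le\|m\|_{C(\mathbb T)}+\sup_{t\in\mathbb T}\int_{|t-\theta|\le\pi}\frac{|m(t)-m(\theta)|}{|t-\theta|}\,d\theta.$$
   Context: $\mathbb T=\mathbb R/(2\pi\mathbb Z)$; functions on $\mathbb T$ (complex-valued) are identified with $2\pi$-periodic functions on $\mathbb R$, and in the integrals $t\in\mathbb R$ is fixed and $\theta$ ranges over the real interval indicated. $C(\mathbb T)$ is the space of continuous functions on $\mathbb T$ with $\|f\|_{C(\mathbb T)}=\sup_{t}|f(t)|$. Fourier coefficients: $\widehat f(k)=\frac1{2\pi}\int_{\mathbb T}f(t)e^{-ikt}dt$, and $S_N(f)(t)=\sum_{|k|\le N}\widehat f(k)e^{ikt}$, $N=0,1,2,\dots$. $U(\mathbb T)$ is the Banach space of all $f\in C(\mathbb T)$ such that $\|f-S_N(f)\|_{C(\mathbb T)}\to0$ as $N\to\infty$, with norm $\|f\|_{U(\mathbb T)}=\sup_N\|S_N(f)\|_{C(\mathbb T)}$. $MU(\mathbb T)$ is the space of pointwise multipliers of $U(\mathbb T)$: all $m\in C(\mathbb T)$ such that $mf\in U(\mathbb T)$ for every $f\in U(\mathbb T)$, with norm $\|m\|_{MU(\mathbb T)}=\sup_{\|f\|_{U(\mathbb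 T)}\le1}\|mf\|_{U(\mathbb T)}$. *)

(* Defs.v *)
From HB Require Import structures.
From mathcomp Require Import all_boot all_order all_algebra.
From mathcomp Require Import all_classical all_reals all_analysis.
From mathcomp Require Export complex.
Set Implicit Arguments.
Unset Strict Implicit.
Unset Printing Implicit Defensive.
Import Order.TTheory GRing.Theory Num.Theory.
Import numFieldNormedType.Exports.
Local Open Scope classical_set_scope.
Local Open Scope ring_scope.

Section torus_function_spaces.
Variable R : realType.
Implicit Types (f m : R -> R[i]) (t x : R).

(* The real-valued modulus; the norm `|z| of R[i] takes its values in R[i]. *)
Definition cmod (z : R[i]) : R := complex.Re `|z|.

(* Functions on R / 2 pi Z are represented by 2 pi-periodic functions on R.
   R[i]^o selects the topology of R[i] given by its norm. *)
Definition CT : set (R -> R[i]) :=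
  [set f | continuous (f : R -> R[i]^o) /\ forall t, f (t + 2 * pi) = f t].

(* The sup and operator norms below take values in the extended reals, so that
   they are meaningful for arbitrary functions. *)
Definition normCT f : \bar R := ereal_sup (range (fun t => (cmod (f t))%:E)).

Definition expi x : R[i] := (cos x +i* sin x)%C.

Definition cintegral (D : set R) (f : R -> R[i]) : R[i] :=
  (Rintegral lebesgue_measure D (fun t => complex.Re (f t)) +i*
   Rintegral lebesgue_measure D (fun t => complex.Im (f t)))%C.

Definition fourier_coef f (k : int) : R[i] :=
  ((2 * pi)^-1)%:C%C *
    cintegral `[- pi, pi] (fun t => f t * expi (- (k%:~R * t))).

(* The index k = j - N runs over the integers with |k| <= N. *)
Definition fourier_sum (N : nat) f : R -> R[i] := fun t =>
  \sum_(j < N.*2.+1)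
    fourier_coef f (j%:Z - N%:Z) * expi ((j%:Z - N%:Z)%:~R * t).

Definition UT : set (R -> R[i]) :=
  [set f | CT f /\
    normCT (fun t => f t - fourier_sum N f t) @[N --> \oo] --> 0%E].

Definition normUT f : \bar R :=
  ereal_sup (range (fun N => normCT (fourier_sum N f))).

Definition MUT : set (R -> R[i]) :=
  [set m | CT m /\ forall f, UT f -> UT (fun t => m t * f t)].

Definition normMUT m : \bar R :=
  ereal_sup [set normUT (fun t => m t * f t) |
              f in [set f | UT f /\ (normUT f <= 1)%E]].

(* At theta = t the integrand is 0 / 0 = 0; this is a single point. *)
Definition dini_sup m (e : R) : \bar R :=
  ereal_sup (range (fun t =>
    (\int[lebesgue_measure]_(theta in [set theta : R | (`|t - theta| <= e)%R])
      (cmod (m t - m theta) / `|t - theta|)%:E)%E)).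

End torus_function_spaces.

(* Main.v *)
(* Write S_N for the partial sums of the Fourier series and D_N for the Dirichlet
   kernel. The commutator of S_N with the multiplication by m is
     S_N (m f) t - m t * S_N f t
       = (2 pi)^-1 * int_{|t - x| <= pi} (m x - m t) f x D_N (t - x) dx,
   and |D_N y| <= 2 pi / |y|, so it is bounded by |f|_C times the Dini integral;
   since |f|_C <= |f|_U, this is the norm estimate. The same estimate gives
   m f \in U as soon as the commutator tends to 0 uniformly in t. For this write
     1 = (1 - cos y) r y + c r y,  with r y = (1 - cos y + c)^-1.
   As D_N y (1 - cos y) = cos (N y) - cos ((N + 1) y), the first term gives
   Fourier coefficients of an equicontinuous family, which are uniformly small
   when N is large. In the second one, c r <= 1 and the Dini condition control
   the points near t, and the smallness of c controls the other points. *)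
Require Import Defs.
From mathcomp Require Import all_boot all_order all_algebra.
From mathcomp Require Import all_classical all_reals all_analysis.
From mathcomp Require Import measurable_realfun ring lra.
Import Order.TTheory GRing.Theory Num.Theory.
Import numFieldNormedType.Exports.
Set Implicit Arguments.
Unset Strict Implicit.
Unset Printing Implicit Defensive.
Local Open Scope classical_set_scope.
Local Open Scope ring_scope.

(** * Complex-valued functions *)

Section modulus.
Variable R : realType.
Implicit Types (z w : R[i]) (x : R).

Lemma normC_cmod z : `|z| = (cmod z)%:C%C.
Proof. by rewrite /cmod normc_def. Qed.

Lemma cmodE z : cmod z = Num.sqrt (complex.Re z ^+ 2 + complex.Im z ^+ 2).
Proof. by rewrite /cmod normc_def. Qed.

Lemma cmod_ge0 z : 0 <= cmod z.
Proof. by rewrite cmodE sqrtr_ge0. Qed.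

Lemma cmodM z w : cmod (z * w) = cmod z * cmod w.
Proof. by apply: (@complexI R); rewrite rmorphM /= -!normC_cmod normrM. Qed.

Lemma cmod0 : cmod (0 : R[i]) = 0.
Proof. by apply: (@complexI R); rewrite -normC_cmod normr0. Qed.

Lemma cmodN z : cmod (- z) = cmod z.
Proof. by rewrite /cmod normrN. Qed.

Lemma cmodB z w : cmod (z - w) = cmod (w - z).
Proof. by rewrite /cmod distrC. Qed.

Lemma ler_cmodD z w : cmod (z + w) <= cmod z + cmod w.
Proof. by rewrite -lecR rmorphD /= -!normC_cmod ler_normD. Qed.

Lemma ler_dist_cmod z w : `|cmod z - cmod w| <= cmod (z - w).
Proof.
rewrite ler_norml lerNl opprB lerBlDr lerBlDr; apply/andP; split.
- by rewrite cmodB -[X in cmod X <= _](subrK z w) ler_cmodD.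
- by rewrite -[X in cmod X <= _](subrK w z) ler_cmodD.
Qed.

Lemma cmodR x : cmod x%:C%C = `|x|.
Proof. by rewrite cmodE /= expr0n /= addr0 sqrtr_sqr. Qed.

Lemma sqr_cmod z : cmod z ^+ 2 = complex.Re z ^+ 2 + complex.Im z ^+ 2.
Proof. by rewrite cmodE sqr_sqrtr// addr_ge0// sqr_ge0. Qed.

Lemma complex_eqP z w : complex.Re z = complex.Re w ->
  complex.Im z = complex.Im w -> z = w.
Proof. by case: z w => [? ?] [? ?] /= -> ->. Qed.

Lemma cReD z w : complex.Re (z + w) = complex.Re z + complex.Re w.
Proof. by case: z w => [? ?] [? ?]. Qed.

Lemma cImD z w : complex.Im (z + w) = complex.Im z + complex.Im w.
Proof. by case: z w => [? ?] [? ?]. Qed.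

Lemma cReM z w : complex.Re (z * w) =
  complex.Re z * complex.Re w - complex.Im z * complex.Im w.
Proof. by case: z w => [? ?] [? ?]. Qed.

Lemma cImM z w : complex.Im (z * w) =
  complex.Re z * complex.Im w + complex.Im z * complex.Re w.
Proof. by case: z w => [? ?] [? ?]. Qed.

Lemma cReB z w : complex.Re (z - w) = complex.Re z - complex.Re w.
Proof. by case: z w => [? ?] [? ?]. Qed.

Lemma cImB z w : complex.Im (z - w) = complex.Im z - complex.Im w.
Proof. by case: z w => [? ?] [? ?]. Qed.

Lemma normRe_le_cmod z : `|complex.Re z| <= cmod z.
Proof. by rewrite -sqrtr_sqr cmodE ler_wsqrtr// lerDl sqr_ge0. Qed.

Lemma normIm_le_cmod z : `|complex.Im z| <= cmod z.
Proof. by rewrite -sqrtr_sqr cmodE ler_wsqrtr// lerDr sqr_ge0. Qed.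

Lemma cmod_le_ReIm z : cmod z <= `|complex.Re z| + `|complex.Im z|.
Proof.
rewrite -(@ler_pXn2r _ 2)// ?nnegrE ?addr_ge0 ?cmod_ge0//.
rewrite sqr_cmod sqrrD !real_normK ?num_real//.
by rewrite -addrA lerD2l lerDr mulrn_wge0// mulr_ge0.
Qed.

End modulus.

(** * Continuity of complex-valued functions of a real variable *)

Section continuity.
Variable R : realType.
Implicit Types (f g : R -> R[i]) (x : R).

(* An inductive wrapper rather than a definition: unfolding [continuous] on
   R[i]^o makes failing unification problems very expensive. *)
Variant ccont f : Prop := Ccont of continuous (f : R -> R[i]^o).

Lemma ccont_near f : ccont f -> forall x (e : R), 0 < e ->
  \forall y \near x, cmod (f x - f y) < e.
Proof.
move=> [fc] x e e0.
have e0' : 0 < e%:C%C :> R[i] by rewrite ltcR.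
have /cvgrPdist_lt/(_ _ e0') := fc x.
by apply: filterS => y; rewrite normC_cmod ltcR.
Qed.

Lemma near_ccont f : (forall x (e : R), 0 < e ->
  \forall y \near x, cmod (f x - f y) < e) -> ccont f.
Proof.
move=> H; split=> x; apply/cvgrPdist_lt => e; rewrite ltcE /= => /andP[/eqP ie e0].
have := H x _ e0; apply: filterS => y; rewrite normC_cmod ltcE /= ie eqxx /=.
by [].
Qed.

Lemma continuous_Re f : ccont f -> continuous (fun x => complex.Re (f x)).
Proof.
move=> fc x; apply/cvgrPdist_lt => e e0.
apply: filterS (ccont_near fc x e0) => y; apply: le_lt_trans => /=.
by apply: le_trans (normRe_le_cmod _); rewrite cReB.
Qed.

Lemma continuous_Im f : ccont f -> continuous (fun x => complex.Im (f x)).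
Proof.
move=> fc x; apply/cvgrPdist_lt => e e0.
apply: filterS (ccont_near fc x e0) => y; apply: le_lt_trans => /=.
by apply: le_trans (normIm_le_cmod _); rewrite cImB.
Qed.

Lemma ccont_ReIm f : continuous (fun x => complex.Re (f x)) ->
  continuous (fun x => complex.Im (f x)) -> ccont f.
Proof.
move=> cr ci; apply: near_ccont => x e e0.
have e2 : 0 < e / 2 by rewrite divr_gt0.
have /cvgrPdist_lt/(_ _ e2) H1 := cr x.
have /cvgrPdist_lt/(_ _ e2) H2 := ci x.
near=> y; apply: le_lt_trans (cmod_le_ReIm _) _.
rewrite cReB cImB [ltRHS]splitr ltrD//.
- by near: y.
- by near: y.
Unshelve. all: by end_near. Qed.

Lemma continuous_cmod f : ccont f -> continuous (fun x => cmod (f x)).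
Proof.
move=> fc x; apply/cvgrPdist_lt => e e0.
apply: filterS (ccont_near fc x e0) => y; apply: le_lt_trans => /=.
exact: ler_dist_cmod.
Qed.

Lemma ccontD f g : ccont f -> ccont g -> ccont (fun x => f x + g x).
Proof. by move=> [fc] [gc]; split=> x; apply: cvgD; [exact: fc | exact: gc]. Qed.

Lemma ccontB f g : ccont f -> ccont g -> ccont (fun x => f x - g x).
Proof. by move=> [fc] [gc]; split=> x; apply: cvgB; [exact: fc | exact: gc]. Qed.

Lemma ccontM f g : ccont f -> ccont g -> ccont (fun x => f x * g x).
Proof. by move=> [fc] [gc]; split=> x; apply: cvgM; [exact: fc | exact: gc]. Qed.

Lemma ccont_cst (z : R[i]) : ccont (fun=> z).
Proof. by split=> x; exact: cvg_cst. Qed.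

Lemma ccontR (h : R -> R) : continuous h -> ccont (fun x => (h x)%:C%C).
Proof. by move=> hc; apply: ccont_ReIm => //; exact: cst_continuous. Qed.

Lemma ccont_comp f (h : R -> R) : ccont f -> continuous h ->
  ccont (fun x => f (h x)).
Proof.
by move=> [fc] hc; split=> x; apply: continuous_comp; [exact: hc|exact: fc].
Qed.

Lemma ccont_sum (I : Type) (r : seq I) (F : I -> R -> R[i]) :
  (forall i, ccont (F i)) -> ccont (fun x => \sum_(i <- r) F i x).
Proof.
move=> Fc; elim: r => [|i r IH].
  rewrite (_ : (fun _ => _) = (fun=> 0)); first exact: ccont_cst.
  by apply/funext => x; rewrite big_nil.
rewrite (_ : (fun _ => _) = (fun x => F i x + \sum_(j <- r) F j x)).
  exact: (ccontD (Fc i) IH).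
by apply/funext => x; rewrite big_cons.
Qed.

Lemma ccont_expi : ccont (@expi R).
Proof.
by apply: ccont_ReIm => x; [exact: continuous_cos|exact: continuous_sin].
Qed.

End continuity.

Lemma CT_ccont (R : realType) (f : R -> R[i]) :
  CT f <-> ccont f /\ forall t, f (t + 2 * pi) = f t.
Proof. by split => -[]; [move=> fc fp; split|move=> [fc] fp]. Qed.

(** * Integrals of continuous complex-valued functions over segments *)

Section complex_integral.
Variable R : realType.
Implicit Types (f g : R -> R[i]) (a b x : R) (h : R -> R).
Local Notation mu := (@lebesgue_measure R).

Lemma continuous_integrable_itv h a b : continuous h ->
  mu.-integrable `[a, b] (EFin \o h).
Proof.
move=> hc; apply: continuous_compact_integrable; first exact: segment_compact.
exact: continuous_subspaceT.
Qed.

Lemma integrable_Re f a b : ccont f ->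
  mu.-integrable `[a, b] (EFin \o (fun x => complex.Re (f x))).
Proof. by move=> /continuous_Re; exact: continuous_integrable_itv. Qed.

Lemma integrable_Im f a b : ccont f ->
  mu.-integrable `[a, b] (EFin \o (fun x => complex.Im (f x))).
Proof. by move=> /continuous_Im; exact: continuous_integrable_itv. Qed.

Lemma eq_cintegral f g (D : set R) : {in D, f =1 g} ->
  cintegral D f = cintegral D g.
Proof.
by move=> fg; rewrite /cintegral; congr Complex; apply: eq_Rintegral => x xD;
  rewrite fg.
Qed.

Lemma cintegralD f g a b : ccont f -> ccont g ->
  cintegral `[a, b] (fun x => f x + g x) =
  cintegral `[a, b] f + cintegral `[a, b] g.
Proof.
move=> fc gc; apply: complex_eqP; rewrite ?cReD ?cImD /=.
- rewrite -RintegralD//; last 2 first; [exact: integrable_Re..|].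
  by apply: eq_Rintegral => x _; rewrite cReD.
- rewrite -RintegralD//; last 2 first; [exact: integrable_Im..|].
  by apply: eq_Rintegral => x _; rewrite cImD.
Qed.

Lemma cintegralZ (z : R[i]) f a b : ccont f ->
  cintegral `[a, b] (fun x => z * f x) = z * cintegral `[a, b] f.
Proof.
move=> fc.
have iRe (r : R) : mu.-integrable `[a, b] (EFin \o (fun x => r * complex.Re (f x))).
  apply: continuous_integrable_itv => x; apply: cvgM; first exact: cvg_cst.
  exact: continuous_Re.
have iIm (r : R) : mu.-integrable `[a, b] (EFin \o (fun x => r * complex.Im (f x))).
  apply: continuous_integrable_itv => x; apply: cvgM; first exact: cvg_cst.
  exact: continuous_Im.
apply: complex_eqP; rewrite ?cReM ?cImM /=;
  rewrite -!RintegralZl//; try exact: integrable_Re; try exact: integrable_Im.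
- by rewrite -RintegralB//; apply: eq_Rintegral => x _; rewrite cReM.
- by rewrite -RintegralD//; apply: eq_Rintegral => x _; rewrite cImM.
Qed.

Lemma cintegralB f g a b : ccont f -> ccont g ->
  cintegral `[a, b] (fun x => f x - g x) =
  cintegral `[a, b] f - cintegral `[a, b] g.
Proof.
move=> fc gc; rewrite -mulN1r -cintegralZ//.
have ngc := ccontM (ccont_cst (-1 : R[i])) gc.
rewrite -(cintegralD _ _ fc ngc).
by apply: eq_cintegral => x _; rewrite mulN1r.
Qed.

Lemma cintegral_sum (I : Type) (r : seq I) (F : I -> R -> R[i]) a b :
  (forall i, ccont (F i)) ->
  cintegral `[a, b] (fun x => \sum_(i <- r) F i x) =
  \sum_(i <- r) cintegral `[a, b] (F i).
Proof.
move=> Fc; elim: r => [|i r IH].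
  rewrite big_nil; transitivity (cintegral `[a, b] (fun x : R => 0 * 0 : R[i])).
    by apply: eq_cintegral => x _; rewrite big_nil mul0r.
  by rewrite cintegralZ ?mul0r//; exact: ccont_cst.
rewrite big_cons -IH -cintegralD//; last exact: ccont_sum.
by apply: eq_cintegral => x _; rewrite big_cons.
Qed.

(* Multiplying by the conjugate of the integral reduces the claim to the real
   part. *)
Lemma cmod_cintegral_le f a b (G : R -> \bar R) : ccont f ->
  measurable_fun `[a, b] G ->
  (forall x, x \in `[a, b] -> ((cmod (f x))%:E <= G x)%E) ->
  ((cmod (cintegral `[a, b] f))%:E <= \int[mu]_(x in `[a, b]) G x)%E.
Proof.
move=> fc mG fG.
pose z := cintegral `[a, b] f.
have cc : continuous (fun x => cmod (f x)) by exact: continuous_cmod.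
apply: (@le_trans _ _ (\int[mu]_(x in `[a, b]) (cmod (f x))%:E)%E); last first.
  apply: ge0_le_integral => //.
  - by move=> x _; rewrite lee_fin cmod_ge0.
  - exact: measurable_int (continuous_integrable_itv a b cc).
have -> : (\int[mu]_(x in `[a, b]) (cmod (f x))%:E)%E =
    (Rintegral mu `[a, b] (fun x => cmod (f x)))%:E.
  rewrite /Rintegral fineK//.
  by apply: integrable_fin_num => //; exact: continuous_integrable_itv.
rewrite lee_fin -/z.
have [->|z0] := eqVneq (cmod z) 0.
  by apply: Rintegral_ge0 => x _; exact: cmod_ge0.
have {}z0 : 0 < cmod z by rewrite lt_neqAle eq_sym z0 cmod_ge0.
rewrite -(ler_pM2l z0) -RintegralZl//; last exact: continuous_integrable_itv.
pose w := (complex.Re z -i* complex.Im z)%C.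
have wz : cmod z * cmod z = complex.Re (w * z).
  by rewrite -expr2 sqr_cmod /w; case: z {z0 w} => u v /=; ring.
have cw : cmod w = cmod z by rewrite !cmodE /w /= sqrrN.
have wc : ccont (fun x => w * f x) := ccontM (ccont_cst w) fc.
rewrite wz /z -cintegralZ//=; apply: le_Rintegral => //.
- exact: integrable_Re.
- apply: continuous_integrable_itv => x; apply: cvgM; first exact: cvg_cst.
  exact: cc.
- move=> x _; rewrite -cw -cmodM.
  exact: le_trans (ler_norm _) (normRe_le_cmod _).
Qed.

Lemma cmod_cintegral_le_cst f a b (M : R) : a <= b -> ccont f ->
  (forall x, x \in `[a, b] -> cmod (f x) <= M) ->
  cmod (cintegral `[a, b] f) <= M * (b - a).
Proof.
move=> ab fc fM; rewrite -lee_fin.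
have := @cmod_cintegral_le f a b (cst M%:E) fc.
rewrite integral_cst// [X in (_ * X)%E]lebesgue_measure_itv/= lte_fin.
have fM' x : x \in `[a, b] -> ((cmod (f x))%:E <= M%:E)%E.
  by move=> /fM; rewrite lee_fin.
move=> /(_ (measurable_cst _) fM') /le_trans; apply.
move: ab; rewrite le_eqVlt => /predU1P[<-|ab].
  by rewrite ltxx mule0 subrr mulr0.
by rewrite ab -EFinD -EFinM.
Qed.

(** The primitive is the integral from [- B], so it is controlled only to the right of that base
    point. Each use takes [B] large enough to enclose all the points involved. *)
Lemma ex_primitive h (B : R) : continuous h ->
  exists F : R -> R, forall x, -B < x < B -> is_derive x 1 F (h x).
Proof.
move=> hc; exists (fun x => Rintegral mu `[- B, x] h) => x /andP[Bx xB].
have [H1 H2] := @continuous_FTC1_closed R h (- B) x B xB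
  (continuous_integrable_itv _ _ hc) Bx (hc x).
by apply: DeriveDef; [exact: H1|rewrite -derive1E].
Qed.

(** The margin 1 on both sides makes [F] differentiable, hence continuous, at the end points too,
    which yields the one-sided limits required by the fundamental theorem. *)
Lemma Rintegral_primitive h (F : R -> R) a b : a < b -> continuous h ->
  (forall x, a - 1 < x < b + 1 -> is_derive x 1 F (h x)) ->
  Rintegral mu `[a, b] h = F b - F a.
Proof.
move=> ab hc HF; rewrite /Rintegral (@continuous_FTC2 _ h F)//.
- exact: continuous_subspaceT.
- have dF x : a - 1 < x < b + 1 -> derivable F x 1.
    by move=> /HF[].
  have cF x : a - 1 < x < b + 1 -> {for x, continuous F}.
    move=> /dF /derivable1_diffP; exact: differentiable_continuous.
  split.
  + move=> x; rewrite in_itv/= => /andP[ax xb]; apply: dF; apply/andP; split; lra.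
  + apply: cvg_at_right_filter; apply: cF; apply/andP; split; lra.
  + apply: cvg_at_left_filter; apply: cF; apply/andP; split; lra.
- move=> x; rewrite in_itv/= => /andP[ax xb]; rewrite derive1E.
  have [] // := HF x _; apply/andP; split; lra.
Qed.

(** Both sides are increments over one period of the same primitive [F], and [F (x + T) - F x] is
    constant because its derivative [h (x + T) - h x] vanishes. This gives translation and change of
    window at once. *)
Lemma Rintegral_shift_period h (T a b d : R) : 0 < T -> continuous h ->
  (forall x, h (x + T) = h x) ->
  Rintegral mu `[a, a + T] (fun x => h (x + d)) = Rintegral mu `[b, b + T] h.
Proof.
move=> T0 hc hT.
(* Large enough for both windows, the translated one included, to lie in the domain of the primitive
   together with their margins of length 1. *)
pose B := `|a| + `|b| + `|d| + `|a + d| + 2 * T + 2.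
have [F HF] := ex_primitive B hc.
have ha := ler_norm a; have hb := ler_norm b; have hd := ler_norm d.
have had := ler_norm (a + d).
have hna := lerNnormlW (lexx `|a|).
have hnb := lerNnormlW (lexx `|b|); have hnd := lerNnormlW (lexx `|d|).
have hnad := lerNnormlW (lexx `|a + d|).
have n1 := normr_ge0 a; have n2 := normr_ge0 b; have n3 := normr_ge0 d.
have n4 := normr_ge0 (a + d).
have dFd x : a - 1 < x < a + T + 1 -> is_derive x 1 (fun y => F (y + d)) (h (x + d)).
  move=> /andP[h1 h2].
  have H : is_derive (x + d) 1 F (h (x + d)).
    by apply: HF; apply/andP; rewrite /B; split; lra.
  have := @is_derive1_comp R F (shift d) x _ _ H (is_derive_shift x 1 d).
  by rewrite mulr1.
have dFb x : b - 1 < x < b + T + 1 -> is_derive x 1 F (h x).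
  by move=> /andP[h1 h2]; apply: HF; apply/andP; rewrite /B; split; lra.
have hdc : continuous (fun x => h (x + d)).
  move=> x; apply: continuous_comp; last exact: hc.
  by apply: cvgD; [exact: cvg_id|exact: cvg_cst].
have aT : a < a + T by rewrite ltrDl.
have bT : b < b + T by rewrite ltrDl.
rewrite (Rintegral_primitive aT hdc dFd) (Rintegral_primitive bT hc dFb).
pose G x := F (x + T) - F x.
have dG x : - B < x < B - T -> is_derive x 1 G 0.
  move=> /andP[h1 h2].
  have H1 : is_derive (x + T) 1 F (h (x + T)).
    by apply: HF; apply/andP; split; lra.
  have H2 : is_derive x 1 F (h x) by apply: HF; apply/andP; split; lra.
  have H3 := @is_derive1_comp R F (shift T) x _ _ H1 (is_derive_shift x 1 T).
  have := is_deriveB H3 H2; rewrite /= mulr1 hT subrr.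
  exact.
have cstG u v : - B < u -> u <= v -> v < B - T -> G u = G v.
  move=> Bu uv vB; apply/eqP; rewrite eq_sym -subr_eq0.
  have [| |c _ ->] := @MVT_segment _ G (fun=> 0) u v uv; last by rewrite mul0r.
  - by move=> x; rewrite in_itv/= => /andP[h1 h2]; apply: dG; apply/andP; split; lra.
  - apply: derivable_within_continuous => x; rewrite in_itv/= => /andP[h1 h2].
    by have [] : is_derive x 1 G 0 by apply: dG; apply/andP; split; lra.
have eG : G (a + d) = G b.
  case/orP: (le_total (a + d) b) => ab; [|symmetry]; apply: cstG => //;
    rewrite /B; lra.
by rewrite [a + T + d]addrAC; exact: eG.
Qed.

End complex_integral.

(** * Periodic functions and the Dirichlet kernel *)

Section periodic.
Variable R : realType.
Implicit Types (f g : R -> R[i]) (t x : R).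

Lemma two_pi_gt0 : 0 < 2 * pi :> R.
Proof. by rewrite mulr_gt0// pi_gt0. Qed.

(** The representative [y] is chosen before [f] and [z]: a second point close to [x] can then be
    transported by the same multiple of the period. *)
Lemma periodic_reduce x : exists2 y, y \in `[0, 2 * pi] &
  forall f, (forall t, f (t + 2 * pi) = f t) -> forall z, f (x + z) = f (y + z).
Proof.
have p0 := two_pi_gt0.
have pos (n : nat) f : (forall t, f (t + 2 * pi) = f t) ->
    forall t, f (t + (2 * pi) *+ n) = f t.
  by move=> fp; exact: periodicn.
pose n := Num.floor (x / (2 * pi)).
have /andP[n1 n2] := floor_itv (x / (2 * pi)).
exists (x - n%:~R * (2 * pi)).
  rewrite in_itv/= subr_ge0 lerBlDr -ler_pdivlMr// n1/=.
  rewrite -[X in _ <= X + _]mul1r -mulrDl -ler_pdivrMr// addrC.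
  by move: n2; rewrite intrD => /ltW.
(* [pos] handles only natural multiples of the period, so the sign of the floor decides on which
   side the periods are added. *)
move=> f fp z; rewrite /n; case: Num.floor => k {n n1 n2}.
- rewrite -(pos k f fp (x - _ + z)); congr f.
  by rewrite -mulr_natl/= pmulrn; ring.
- rewrite -(pos k.+1 f fp (x + z)); congr f.
  by rewrite -mulr_natl NegzE intrN pmulrn; ring.
Qed.

Lemma CT_bounded f : CT f -> exists2 M : R, 0 < M & forall t, cmod (f t) <= M.
Proof.
move=> /CT_ccont[fc fp].
have [c _ Hc] := @EVT_max R (fun t => cmod (f t)) 0 (2 * pi) (ltW two_pi_gt0)
  (continuous_subspaceT (continuous_cmod fc)).
(* Adding 1 makes the bound strictly positive, so that it can serve as a divisor later. *)
exists (cmod (f c) + 1) => [|t]; first by rewrite ltr_wpDl// cmod_ge0.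
have [y yI H] := periodic_reduce t.
have := H _ fp 0; rewrite !addr0 => ->.
by rewrite (le_trans (Hc _ yI))// lerDl.
Qed.

(** Heine's theorem on one compact period. Only [x] is confined to the period while [y] is any real
    number, so pairs straddling an end of the period need no separate treatment. *)
Lemma CT_uniformly_continuous f (e : R) : CT f -> 0 < e ->
  exists2 d : R, 0 < d & forall x y, `|x - y| < d -> cmod (f x - f y) < e.
Proof.
move=> /CT_ccont[fc fp] e0.
have e2 : 0 < e / 2 by rewrite divr_gt0.
have cK : compact `[0, 2 * pi : R]%classic by exact: segment_compact.
have /compact_near_coveringP/(_ R (0^'+)
  (fun d x => forall y, `|x - y| < d -> cmod (f x - f y) < e)) := cK.
case=> [x _|r /= r0 Hr].
  have /nbhs_ballP[r /= r0 Hr] := ccont_near fc x e2.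
  (* If [x'] is within [r / 2] of [x] and [y] within [r / 2] of [x'], both lie in the ball of radius
     [r] given by continuity at [x]. *)
  have r2 : 0 < r / 2 by rewrite divr_gt0.
  exists (ball x (r / 2), [set d | d < r / 2]) => /=.
    by split; [exact: nbhsx_ballx|exact: nbhs_right_lt].
  move=> [x' d] /= [xx' dr] y x'y.
  have h1 : cmod (f x - f x') < e / 2.
    by apply: Hr; apply: le_ball xx'; rewrite ler_pdivrMr// ler_peMr ?ler1n// ltW.
  have h2 : cmod (f x - f y) < e / 2.
    apply: Hr; rewrite /ball/= [ltRHS]splitr -(subrKA x').
    by rewrite (le_lt_trans (ler_normD _ _))// ltrD// (lt_trans x'y).
  have -> : f x' - f y = (f x - f y) - (f x - f x') by ring.
  rewrite (le_lt_trans (ler_cmodD _ _))// cmodN [ltRHS]splitr ltrD//.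
exists (r / 2) => [|x y xy]; first by rewrite divr_gt0.
have [z zI Hz] := periodic_reduce x.
have := Hz _ fp 0; rewrite !addr0 => ->.
have := Hz _ fp (y - x); rewrite addrC subrK => ->.
apply: (Hr (r / 2)) => //.
- by rewrite /= sub0r normrN gtr0_norm ?divr_gt0// gtr_pMr// invf_lt1// ltr1n.
- by rewrite divr_gt0.
- by rewrite opprD addrA subrr add0r opprB.
Qed.

End periodic.

(** * The Dirichlet kernel and its pointwise bound *)

Section dirichlet_kernel.
Variable R : realType.
Implicit Types (f g : R -> R[i]) (t x : R).

Definition dirichlet (N : nat) x : R := 1 + \sum_(i < N) 2 * cos (i.+1%:R * x).

Lemma expiD x y : expi (x + y) = expi x * expi y.
Proof. by apply: complex_eqP; rewrite ?cReM ?cImM /= ?cosD ?sinD // addrC. Qed.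

Lemma dirichletS N x :
  dirichlet N.+1 x = dirichlet N x + 2 * cos (N.+1%:R * x).
Proof. by rewrite /dirichlet big_ord_recr /= addrA. Qed.

Lemma sum_expi N x :
  \sum_(j < N.*2.+1) expi ((j%:Z - N%:Z)%:~R * x) = (dirichlet N x)%:C%C.
Proof.
elim: N => [|N IH].
  rewrite big_ord1 subrr mul0r /dirichlet big_ord0 addr0.
  by rewrite /expi cos0 sin0.
rewrite doubleS big_ord_recr big_ord_recl /=.
(* Passing from [N] to [N.+1] adds one frequency at each end; the old frequencies keep their values
   but their indices move up by one. *)
under eq_bigr => i _.
  rewrite (_ : (bump 0 i)%:Z - N.+1%:Z = i%:Z - N%:Z); last first.
    by rewrite /bump/= add1n !intS; ring.
  over.
rewrite IH dirichletS sub0r (_ : N.*2.+2%:Z - N.+1%:Z = N.+1%:Z); last first.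
  by rewrite -doubleS -addnn PoszD addrK.
rewrite intrN mulNr; apply: complex_eqP; rewrite ?cReD ?cImD /=.
  by rewrite cosN; ring.
by rewrite sinN; ring.
Qed.

(** Multiplication by [1 - cos x] turns the cosines into second differences, and the sum telescopes.
    Without a division the identity also covers the zeros of [1 - cos x]. *)
Lemma dirichlet_mul N x :
  dirichlet N x * (1 - cos x) = cos (N%:R * x) - cos (N.+1%:R * x).
Proof.
elim: N => [|N IH]; first by rewrite /dirichlet big_ord0 addr0 !mul1r mul0r cos0.
rewrite dirichletS mulrDl IH.
have -> : N%:R * x = N.+1%:R * x - x by rewrite -[N.+1%:R]natr1; ring.
have -> : N.+2%:R * x = N.+1%:R * x + x by rewrite -[N.+2%:R]natr1; ring.
by rewrite cosB cosD; ring.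
Qed.

Lemma continuous_dirichlet N : continuous (dirichlet N).
Proof.
elim: N => [|N IH].
  rewrite (_ : dirichlet 0 = cst 1); first exact: cst_continuous.
  by apply/funext => x; rewrite /dirichlet big_ord0 addr0.
rewrite (_ : dirichlet N.+1 =
  fun x => dirichlet N x + 2 * cos (N.+1%:R * x)); last first.
  by apply/funext => x; rewrite dirichletS.
move=> x; apply: cvgD; first exact: IH.
apply: cvgM; first exact: cvg_cst.
apply: (@continuous_comp _ _ _ (fun x : R => N.+1%:R * x) (@cos R)).
  by apply: cvgM; [exact: cvg_cst|exact: cvg_id].
exact: continuous_cos.
Qed.

Lemma dirichlet_periodic N x : dirichlet N (x + 2 * pi) = dirichlet N x.
Proof.
rewrite /dirichlet; congr (_ + _); apply: eq_bigr => i _; congr (_ * _).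
rewrite mulrDr [_ * (2 * pi)]mulr_natl [2 * pi]mulr_natl.
by rewrite (periodicn (@cosD2pi R)).
Qed.

(* The loss with respect to Jordan's inequality [2 / pi * y <= sin y] is
   harmless. *)
Lemma sin_ge_div_pi (y : R) : 0 <= y <= pi / 2 -> y / pi <= sin y.
Proof.
move=> /andP[y0 yp].
have p2 := @pi_ge2 R; have p0 := @pi_gt0 R.
have cy : y * cos y <= sin y.
  move: y0; rewrite le_eqVlt => /predU1P[<-|y0]; first by rewrite mul0r sin0.
  have [c] := @MVT R (@sin R) (@cos R) 0 y y0 (fun x _ => is_derive_sin x)
    (continuous_subspaceT (@continuous_sin R)).
  rewrite in_itv/= sin0 !subr0 => /andP[c0 cy] ->.
  rewrite mulrC ler_pM2r// ltW// ltr_cos// in_itv/= ltW//=; lra.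
have ch : cos y >= 0 by apply: cos_ge0_pihalf; apply/andP; split; lra.
have yp1 : y / pi <= 1 / 2 by rewrite ler_pdivrMr//; lra.
have yp2 : y / pi <= y / 2 by rewrite ler_wpM2l// lef_pV2// posrE.
have s0 : 0 <= sin y by apply: sin_ge0_pi; apply/andP; split; lra.
have cs := cos2Dsin2 y.
(* If [cos y] is at least 1/2, then [sin y] is at least [y / 2], hence at least [y / pi]. Otherwise
   $\sin^2 y > 3/4$, so [sin y] exceeds 1/2, which bounds [y / pi]. *)
case: (lerP (1 / 2) (cos y)) => h; last by nra.
by nra.
Qed.

Lemma sqr_sin_half x : 1 - cos x = 2 * sin (x / 2) ^+ 2.
Proof.
have -> : cos x = cos ((x / 2) *+ 2) by congr cos; rewrite -[RHS]mulr_natl; field.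
by rewrite cos_mulr2n cos2sin2 -[(1 - _) *+ 2]mulr_natl; ring.
Qed.

Lemma norm_sin_half_ge x : `|x| <= pi -> `|x| / (2 * pi) <= `|sin (x / 2)|.
Proof.
move=> xpi; have p0 := @pi_gt0 R.
have h : `|x| / 2 / pi <= sin (`|x| / 2).
  by apply: sin_ge_div_pi; rewrite divr_ge0//= ler_pM2r// invr_gt0.
rewrite invfM mulrA (le_trans h)//.
case: (ger0P x) => _; first exact: ler_norm.
by rewrite mulNr sinN -normrN ler_norm.
Qed.

Lemma one_sub_cos_ge x : `|x| <= pi ->
  x ^+ 2 / (2 * pi ^+ 2) <= 1 - cos x.
Proof.
move=> xpi; have p0 := @pi_gt0 R; rewrite sqr_sin_half.
have h : (`|x| / (2 * pi)) ^+ 2 <= sin (x / 2) ^+ 2.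
  rewrite -[leRHS]real_normK ?num_real// ler_pXn2r ?norm_sin_half_ge// nnegrE.
  by rewrite divr_ge0// mulr_ge0// ltW.
apply: (@le_trans _ _ (2 * (`|x| / (2 * pi)) ^+ 2)); last by rewrite ler_pM2l.
rewrite expr_div_n real_normK ?num_real// le_eqVlt; apply/orP; left; apply/eqP.
have := lt0r_neq0 p0; move: (pi : R) => q q0.
by field.
Qed.

(** Cancelling [2 * sin (x / 2)] in [dirichlet_mul] gives $D_N(x)\sin(x/2)=\sin((N+1/2)x)$, of
    modulus at most 1; the lower bound on [sin (x / 2)] then provides the constant [2 * pi]. *)
Lemma dirichlet_le N x : x != 0 -> `|x| <= pi ->
  `|dirichlet N x| <= 2 * pi / `|x|.
Proof.
move=> x0 xpi; have p0 := @pi_gt0 R.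
have sx := norm_sin_half_ge xpi.
have nx : 0 < `|x| by rewrite normr_gt0.
have s0 : 0 < `|sin (x / 2)| by rewrite (lt_le_trans _ sx)// divr_gt0// mulr_gt0.
have cB : cos (N%:R * x) - cos (N.+1%:R * x) =
    2 * sin ((N%:R + 2^-1) * x) * sin (x / 2).
  have -> : N%:R * x = (N%:R + 2^-1) * x - x / 2 by rewrite mulrDl mulrC; ring.
  have -> : N.+1%:R * x = (N%:R + 2^-1) * x + x / 2.
    by rewrite -natr1; field.
  by rewrite cosB cosD; ring.
have H : `|dirichlet N x| * `|sin (x / 2)| <= 1.
  have := dirichlet_mul N x; rewrite cB sqr_sin_half => e.
  have s0' : sin (x / 2) != 0 by rewrite -normr_gt0.
  have {}e : dirichlet N x * sin (x / 2) = sin ((N%:R + 2^-1) * x).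
    apply: (mulIf s0'); apply: (@mulfI _ 2) => //.
    by rewrite [RHS]mulrA -e; ring.
  by rewrite -normrM e sin_max.
rewrite ler_pdivlMr//.
have h2 : `|x| <= 2 * pi * `|sin (x / 2)|.
  by rewrite mulrC -ler_pdivrMr// mulr_gt0.
have D0 := normr_ge0 (dirichlet N x).
apply: (le_trans (ler_wpM2l D0 h2)).
rewrite mulrCA -[leRHS]mulr1 ler_pM2l// mulr_gt0//.
Qed.

End dirichlet_kernel.

(** * Partial sums as convolutions, and their commutator with a multiplication *)

Section fourier_sums.
Variable R : realType.
Implicit Types (f g m : R -> R[i]) (t x : R) (F G : R -> R -> R[i]).
Local Notation mu := (@lebesgue_measure R).

Lemma cintegral_shift_period f (a b d : R) :
  ccont f -> (forall x, f (x + 2 * pi) = f x) ->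
  cintegral `[a, a + 2 * pi] (fun x => f (x + d)) =
  cintegral `[b, b + 2 * pi] f.
Proof.
move=> fc fp; have p0 := @two_pi_gt0 R; apply: complex_eqP => /=.
- apply: (Rintegral_shift_period _ _ _ p0 (continuous_Re fc)) => x.
  by rewrite fp.
- apply: (Rintegral_shift_period _ _ _ p0 (continuous_Im fc)) => x.
  by rewrite fp.
Qed.

Lemma add_two_pi t : t + pi = t - pi + 2 * pi.
Proof. by rewrite mulr_natl mulr2n; ring. Qed.

Lemma cintegral_period f t : ccont f -> (forall x, f (x + 2 * pi) = f x) ->
  cintegral `[t - pi, t + pi] f = cintegral `[- pi, pi] f.
Proof.
move=> fc fp.
rewrite add_two_pi -[X in `[- _, X]]add0r add_two_pi sub0r.
rewrite -(cintegral_shift_period (t - pi) (- pi) 0 fc fp).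
by apply: eq_cintegral => x _; rewrite addr0.
Qed.

Lemma CT_mul f g : CT f -> CT g -> CT (fun x => f x * g x).
Proof.
move=> /CT_ccont[fc fp] /CT_ccont[gc gp]; apply/CT_ccont; split.
  exact: ccontM.
by move=> t; rewrite fp gp.
Qed.

Lemma continuous_reflect t : continuous (fun x : R => t - x).
Proof. by move=> x; apply: cvgB; [exact: cvg_cst|exact: cvg_id]. Qed.

Lemma ccont_dirichlet N t : ccont (fun x => (dirichlet N (t - x))%:C%C).
Proof.
apply: (@ccont_comp _ (fun x => (dirichlet N x)%:C%C)).
  by apply: ccontR; exact: continuous_dirichlet.
exact: continuous_reflect.
Qed.

Lemma dirichlet_reflect_periodic N t x :
  dirichlet N (t - (x + 2 * pi)) = dirichlet N (t - x).
Proof. by rewrite opprD addrA -[LHS]dirichlet_periodic subrK. Qed.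

(** By periodicity the window may be centred at [t]. The argument [t - x] of the kernel then stays
    in $[-\pi,\pi]$, where [dirichlet_le] applies, and the window is the domain of the Dini
    integral. *)
Lemma fourier_sumE f N t : CT f ->
  fourier_sum N f t = ((2 * pi)^-1)%:C%C *
    cintegral `[t - pi, t + pi] (fun x => f x * (dirichlet N (t - x))%:C%C).
Proof.
move=> /CT_ccont[fc fp].
rewrite cintegral_period; last 2 first.
- exact: (ccontM fc (ccont_dirichlet N t)).
- by move=> x; rewrite fp dirichlet_reflect_periodic.
pose e (j : 'I_N.*2.+1) : R := (j%:Z - N%:Z)%:~R.
have ec j : ccont (fun x => expi (- (e j * x))).
  apply: ccont_comp; first exact: ccont_expi.
  by move=> x; apply: cvgN; apply: cvgM; [exact: cvg_cst|exact: cvg_id].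
(* The kernel is expanded into exponentials of [t - x], each of which splits into a factor in [t]
   and a factor in [x]. *)
rewrite (_ : cintegral _ _ = cintegral `[- pi, pi] (fun x =>
   \sum_(j < N.*2.+1) expi (e j * t) * (f x * expi (- (e j * x))))); last first.
  apply: eq_cintegral => x _; rewrite -sum_expi mulr_sumr.
  apply: eq_bigr => j _.
  by rewrite mulrCA -expiD mulrBr.
rewrite cintegral_sum => [|j]; last first.
  exact: (ccontM (ccont_cst _) (ccontM fc (ec j))).
rewrite mulr_sumr /fourier_sum; apply: eq_bigr => j _.
rewrite cintegralZ; last exact: (ccontM fc (ec j)).
by rewrite /fourier_coef -mulrA; congr (_ * _); rewrite mulrC.
Qed.

(** The normalising constant stands under the integral so that the integrand itself can be compared
    pointwise with the Dini quotient. *)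
Definition commutator m f (N : nat) t : R[i] :=
  cintegral `[t - pi, t + pi] (fun x =>
    (((2 * pi)^-1)%:C%C * ((m x - m t) * f x)) * (dirichlet N (t - x))%:C%C).

Lemma fourier_sum_mul m f N t : CT m -> CT f ->
  fourier_sum N (fun x => m x * f x) t =
  m t * fourier_sum N f t + commutator m f N t.
Proof.
move=> Cm Cf; rewrite !fourier_sumE//; last exact: CT_mul.
have [mc mp] := (CT_ccont m).1 Cm; have [fc fp] := (CT_ccont f).1 Cf.
have dc := ccont_dirichlet N t.
have fdc := ccontM fc dc.
have mfdc := ccontM (ccontM mc fc) dc.
rewrite mulrCA.
have mBc := ccontB mc (ccont_cst (m t)).
rewrite /commutator.
rewrite [X in _ = _ + X](_ : _ = ((2 * pi)^-1)%:C%C *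
  cintegral `[t - pi, t + pi] (fun x =>
     ((m x - m t) * f x) * (dirichlet N (t - x))%:C%C)); last first.
  rewrite -cintegralZ; last exact: (ccontM (ccontM mBc fc) dc).
  by apply: eq_cintegral => x _; rewrite -[LHS]mulrA.
rewrite -mulrDr; congr (_ * _).
rewrite -cintegralZ// -cintegralD; last 2 first.
- exact: (ccontM (ccont_cst _) fdc).
- exact: (ccontM (ccontM mBc fc) dc).
by apply: eq_cintegral => x _ /=; ring.
Qed.

End fourier_sums.

(** * A uniform Riemann-Lebesgue lemma *)

Section equicontinuous_families.
Variable R : realType.
Implicit Types (f g m : R -> R[i]) (t x : R) (F G : R -> R -> R[i]).

Definition bounded_family F :=
  exists2 M : R, 0 < M & forall t x, cmod (F t x) <= M.

Definition equicontinuous_family F := forall e : R, 0 < e ->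
  exists2 d : R, 0 < d & forall t x y, `|x - y| < d -> cmod (F t x - F t y) < e.

(** The index [t] is the point at which a partial sum is evaluated, and all bounds are uniform in
    it. Boundedness is carried along because products of equicontinuous families require it. *)
Definition good_family F := bounded_family F /\ equicontinuous_family F.

Lemma good_familyM F G : good_family F -> good_family G ->
  good_family (fun t x => F t x * G t x).
Proof.
move=> [[M M0 FM] eF] [[K K0 GK] eG]; split.
  exists (M * K); first by rewrite mulr_gt0.
  by move=> t x; rewrite cmodM ler_pM ?cmod_ge0.
move=> e e0.
have eM0 : 0 < e / 2 / M by rewrite !divr_gt0.
have eK0 : 0 < e / 2 / K by rewrite !divr_gt0.
have [d1 d10 H1] := eF _ eK0; have [d2 d20 H2] := eG _ eM0.
exists (Num.min d1 d2) => [|t x y]; first by rewrite lt_min d10.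
rewrite lt_min => /andP[xy1 xy2].
have -> : F t x * G t x - F t y * G t y =
    (F t x - F t y) * G t x + F t y * (G t x - G t y) by ring.
rewrite (le_lt_trans (ler_cmodD _ _))// !cmodM [ltRHS]splitr ltrD//.
- rewrite (le_lt_trans (ler_wpM2l (cmod_ge0 _) (GK t x)))//.
  by rewrite -ltr_pdivlMr//; exact: H1.
- rewrite (le_lt_trans (ler_wpM2r (cmod_ge0 _) (FM t y)))//.
  by rewrite mulrC -ltr_pdivlMr//; exact: H2.
Qed.

Lemma good_familyB F G : good_family F -> good_family G ->
  good_family (fun t x => F t x - G t x).
Proof.
move=> [[M M0 FM] eF] [[K K0 GK] eG]; split.
  exists (M + K); first by rewrite addr_gt0.
  by move=> t x; rewrite (le_trans (ler_cmodD _ _))// cmodN lerD.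
move=> e e0.
have e20 : 0 < e / 2 by rewrite !divr_gt0.
have [d1 d10 H1] := eF _ e20; have [d2 d20 H2] := eG _ e20.
exists (Num.min d1 d2) => [|t x y]; first by rewrite lt_min d10.
rewrite lt_min => /andP[xy1 xy2].
have -> : F t x - G t x - (F t y - G t y) =
    (F t x - F t y) - (G t x - G t y) by ring.
rewrite (le_lt_trans (ler_cmodD _ _))// cmodN [ltRHS]splitr ltrD//.
- exact: H1.
- exact: H2.
Qed.

Lemma good_family_CT f : CT f -> good_family (fun _ x => f x).
Proof.
move=> Cf; split.
  by have [M M0 fM] := CT_bounded Cf; exists M.
move=> e e0; have [d d0 H] := CT_uniformly_continuous Cf e0.
by exists d => // _; exact: H.
Qed.

Lemma good_family_cst m : CT m -> good_family (fun t _ => m t).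
Proof.
move=> Cm; split.
  by have [M M0 fM] := CT_bounded Cm; exists M.
by move=> e e0; exists 1 => // t x y _; rewrite subrr cmod0.
Qed.

Lemma good_family_reflect f : CT f -> good_family (fun t x => f (t - x)).
Proof.
move=> Cf; split.
  by have [M M0 fM] := CT_bounded Cf; exists M.
move=> e e0; have [d d0 H] := CT_uniformly_continuous Cf e0.
exists d => // t x y xy; apply: H.
by rewrite distrC (_ : t - y - (t - x) = x - y)//; ring.
Qed.

(* A translation by [pi / n] changes the sign of [cos (n * (t - x))]. *)
Lemma uniform_Riemann_Lebesgue F (e : R) : (forall t, ccont (F t)) ->
  (forall t x, F t (x + 2 * pi) = F t x) -> equicontinuous_family F -> 0 < e ->
  exists N : nat, forall n t, (N <= n)%N ->
  cmod (cintegral `[t - pi, t + pi]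
    (fun x => F t x * (cos (n%:R * (t - x)))%:C%C)) <= e.
Proof.
move=> Fc Fp Fe e0.
have p0 := @pi_gt0 R.
have ep0 : 0 < e / pi by rewrite divr_gt0.
have [d d0 Hd] := Fe _ ep0.
(* From this rank on, [pi / n] is less than [d], so the translation changes [F t] by less than
   [e / pi]. *)
exists (Num.trunc (pi / d)).+1 => n t Nn.
have n0 : 0 < n%:R :> R by rewrite ltr0n (leq_trans _ Nn).
have nd : pi / n%:R < d.
  rewrite ltr_pdivrMr// mulrC -ltr_pdivrMr//.
  rewrite (lt_le_trans (truncnS_gt _))// ler_nat//.
have ccos s : ccont (fun x => (cos (n%:R * (s - x)))%:C%C).
  apply: ccontR => x; apply: (@continuous_comp _ _ _
    (fun x => n%:R * (s - x)) (@cos R)); last exact: continuous_cos.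
  by apply: cvgM; [exact: cvg_cst|exact: continuous_reflect].
pose g x := F t x * (cos (n%:R * (t - x)))%:C%C.
have gc : ccont g := ccontM (Fc t) (ccos t).
have gp x : g (x + 2 * pi) = g x.
  rewrite /g Fp; congr (_ * (_)%:C%C).
  rewrite -[LHS](periodicn (@cosD2pi R) n); congr cos.
  by rewrite -[(pi *+ 2) *+ n]mulr_natl -[pi *+ 2]mulr_natl; ring.
have Fsc : ccont (fun x => F t (x + pi / n%:R)).
  apply: ccont_comp => //.
  by move=> x; apply: cvgD; [exact: cvg_id|exact: cvg_cst].
have Hs : cintegral `[t - pi, t + pi] g =
    cintegral `[t - pi, t + pi]
      (fun x => -1 * (F t (x + pi / n%:R) * (cos (n%:R * (t - x)))%:C%C)).
  rewrite add_two_pi -(cintegral_shift_period (t - pi) (t - pi) (pi / n%:R) gc gp).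
  apply: eq_cintegral => x _; rewrite /g.
  have -> : cos (n%:R * (t - (x + pi / n%:R))) = - cos (n%:R * (t - x)).
    rewrite (_ : n%:R * (t - x) = n%:R * (t - (x + pi / n%:R)) + pi).
      by rewrite cosDpi opprK.
    have := lt0r_neq0 n0; move: (pi : R) (n%:R : R) => q k k0.
    by field.
  by rewrite rmorphN mulrN mulN1r.
(* Adding the two expressions of the integral leaves an increment of [F t]. As the window has length
   [2 * pi], twice the integral is at most [2 * e] in modulus. *)
have H2 : 2 * cintegral `[t - pi, t + pi] g = cintegral `[t - pi, t + pi]
    (fun x => (F t x - F t (x + pi / n%:R)) * (cos (n%:R * (t - x)))%:C%C).
  rewrite mulr_natl mulr2n {2}Hs -cintegralD//; last first.
    exact: (ccontM (ccont_cst _) (ccontM Fsc (ccos t))).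
  by apply: eq_cintegral => x _; rewrite /g; ring.
have : cmod (2 * cintegral `[t - pi, t + pi] g) <= e / pi * (t + pi - (t - pi)).
  rewrite H2; apply: cmod_cintegral_le_cst.
  - by rewrite lerD2l ge0_cp// ltW.
  - exact: (ccontM (ccontB (Fc t) Fsc) (ccos t)).
  - move=> x _; rewrite cmodM cmodR -[leRHS]mulr1 ler_pM ?cmod_ge0 ?cos_max//.
    apply/ltW/Hd.
    rewrite opprD addrA subrr add0r normrN ger0_norm// divr_ge0// ltW//.
rewrite cmodM (_ : cmod 2 = 2); last first.
  by rewrite -[2]/(2%:R) -(rmorph_nat (real_complex R)) cmodR normr_nat.
rewrite (_ : e / pi * _ = 2 * e); first by rewrite ler_pM2l.
have := lt0r_neq0 p0; move: (pi : R) => q q0.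
by field.
Qed.

End equicontinuous_families.

(** * Estimates of the commutator *)

Section estimates.
Variable R : realType.
Implicit Types (f g m : R -> R[i]) (t x : R).
Local Notation mu := (@lebesgue_measure R).

Definition regularizer (c x : R) : R := (1 - cos x + c)^-1.

Lemma regularizer_den_gt0 (c x : R) : 0 < c -> 0 < 1 - cos x + c.
Proof. by move=> c0; rewrite ltr_wpDl// subr_ge0 cos_le1. Qed.

Lemma CT_regularizer (c : R) : 0 < c ->
  CT (fun x => (regularizer c x)%:C%C : R[i]).
Proof.
move=> c0; apply/CT_ccont; split.
  apply: ccontR => x; apply: cvgV.
    by rewrite gt_eqF// regularizer_den_gt0.
  apply: cvgD; last exact: cvg_cst.
  by apply: cvgB; [exact: cvg_cst|exact: continuous_cos].
move=> t; rewrite /regularizer.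
by rewrite (_ : t + 2 * pi = t + pi *+ 2) ?cosD2pi// mulr_natl.
Qed.

Lemma dini_domainE t (e : R) : [set x : R | `|t - x| <= e] = `[t - e, t + e]%classic.
Proof.
by apply/seteqP; split => x /=; rewrite in_itv/= ler_distlC.
Qed.

Lemma measurable_dini m t (D : set R) : CT m ->
  measurable_fun D (fun x => (cmod (m t - m x) / `|t - x|)%:E).
Proof.
move=> /CT_ccont[mc mp]; apply: measurable_funS (@measurableT _ R) _ _ => //.
apply/measurable_EFinP; apply: measurable_funM.
  apply: continuous_measurable_fun.
  exact: continuous_cmod (ccontB (ccont_cst _) mc).
(* The inverse is discontinuous at [x = t], so measurability is taken from [powR]; both functions
   are 0 at that point. *)
rewrite (_ : (fun x => `|t - x|^-1) = (fun x => powR `|t - x| (-1))).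
  apply: (measurableT_comp (measurable_powR _)).
  apply: (measurableT_comp (@normr_measurable R _)).
  by apply: continuous_measurable_fun; exact: continuous_reflect.
by apply/funext => x; rewrite powR_inv1.
Qed.

(** The [2 * pi] of [dirichlet_le] cancels the normalising factor exactly, whence the constant 1 in
    front of the Dini integral in the final estimate. *)
Lemma commutator_integrand_le m f N t x (K : R) : 0 <= K -> cmod (f x) <= K ->
  `|t - x| <= pi ->
  cmod (((2 * pi)^-1)%:C%C * ((m x - m t) * f x) * (dirichlet N (t - x))%:C%C)
  <= K * (cmod (m t - m x) / `|t - x|).
Proof.
move=> K0 fK tx; have p0 := @two_pi_gt0 R.
have [->|xt] := eqVneq x t.
  by rewrite !subrr mul0r mulr0 mul0r cmod0 mul0r mulr0.
have tx0 : t - x != 0 by rewrite subr_eq0 eq_sym.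
have n0 : 0 <= (2 * pi)^-1 :> R by rewrite invr_ge0 ltW.
rewrite !cmodM !cmodR (ger0_norm n0).
rewrite (cmodB (m x)).
have -> : K * (cmod (m t - m x) / `|t - x|) =
    (2 * pi)^-1 * (cmod (m t - m x) * K) * (2 * pi / `|t - x|).
  have := lt0r_neq0 p0; move: (2 * pi) => q q0.
  have : `|t - x| != 0 by rewrite normr_eq0.
  by move: (`|t - x|) => a a0; field; rewrite a0.
apply: ler_pM => //; last exact: dirichlet_le.
  by rewrite mulr_ge0// mulr_ge0 ?cmod_ge0.
by rewrite ler_wpM2l// ler_wpM2l// cmod_ge0.
Qed.

Lemma commutator_le m f N t (K : R) : CT m -> CT f -> 0 <= K ->
  (forall x, cmod (f x) <= K) ->
  ((cmod (commutator m f N t))%:E <= K%:E * dini_sup m pi)%E.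
Proof.
move=> Cm Cf K0 fK.
have [mc mp] := (CT_ccont m).1 Cm; have [fc fp] := (CT_ccont f).1 Cf.
have mBc := ccontB mc (ccont_cst (m t)).
apply: (@le_trans _ _ (\int[mu]_(x in `[(t - pi)%R, (t + pi)%R])
    (K%:E * (cmod (m t - m x) / `|t - x|)%:E))%E).
  apply: cmod_cintegral_le.
  - exact: (ccontM (ccontM (ccont_cst _) (ccontM mBc fc)) (ccont_dirichlet N t)).
  - by apply: measurable_funeM; exact: measurable_dini.
  - move=> x; rewrite in_itv/= -ler_distlC => tx.
    by rewrite -EFinM lee_fin; exact: commutator_integrand_le.
rewrite ge0_integralZl_EFin//; last 2 first.
- by move=> x _; rewrite lee_fin divr_ge0 ?cmod_ge0.
- exact: measurable_dini.
rewrite lee_wpmul2l ?lee_fin// -dini_domainE.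
by apply: ereal_sup_ubound; exists t.
Qed.

Lemma regularizer_split N (c x : R) : 0 < c ->
  dirichlet N x = regularizer c x * (cos (N%:R * x) - cos (N.+1%:R * x)) +
    c * regularizer c x * dirichlet N x.
Proof.
move=> c0; rewrite -dirichlet_mul /regularizer.
have := lt0r_neq0 (regularizer_den_gt0 x c0).
by move: (dirichlet N x) (cos x) => D y y0; field.
Qed.

(** Dropping [c] from the denominator leaves [1 - cos x], which [one_sub_cos_ge] bounds below. The
    result is linear in [c], so a small [c] beats any fixed [e]. *)
Lemma regularizer_far_le (c x e : R) : 0 < c -> 0 < e -> e < `|x| -> `|x| <= pi ->
  c * regularizer c x <= c * (2 * pi ^+ 2 / e ^+ 2).
Proof.
move=> c0 e0 ex xpi; rewrite ler_pM2l//.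
have p0 := @pi_gt0 R.
rewrite /regularizer -[leRHS]invrK lef_pV2 ?posrE ?regularizer_den_gt0//; last first.
  by rewrite invr_gt0 divr_gt0// ?mulr_gt0// exprn_gt0.
rewrite invf_div; apply: (@le_trans _ _ (x ^+ 2 / (2 * pi ^+ 2))).
  rewrite ler_pM2r ?invr_gt0 ?mulr_gt0 ?exprn_gt0//.
  rewrite -[x ^+ 2]real_normK ?num_real// ler_pXn2r ?nnegrE// ltW//.
by rewrite (le_trans (one_sub_cos_ge xpi))// lerDl ltW.
Qed.

Lemma regularizer_near_le (c x : R) : 0 < c -> c * regularizer c x <= 1.
Proof.
move=> c0; rewrite /regularizer ler_pdivrMr ?regularizer_den_gt0// mul1r.
by rewrite lerDr subr_ge0 cos_le1.
Qed.

End estimates.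

(** * Convergence to zero in the extended reals *)

Section ereal_limits.
Context {R : realType} {T : Type} {F : set_system T} {FF : Filter F}.
Implicit Types u : T -> \bar R.

Lemma ereal_cvg0_le u (e : R) : u @ F --> 0%E -> 0 < e ->
  \forall x \near F, (u x <= e%:E)%E.
Proof.
move=> /fine_cvgP[uf /cvgrPdist_le u0] e0; have := u0 _ e0.
apply: filterS2 uf => x ux; rewrite sub0r normrN => h.
by rewrite -(fineK ux) lee_fin (le_trans (ler_norm _)).
Qed.

Lemma ereal_cvg0 u : (forall x, (0 <= u x)%E) ->
  (forall e : R, 0 < e -> \forall x \near F, (u x <= e%:E)%E) -> u @ F --> 0%E.
Proof.
move=> u0 H; apply/fine_cvgP.
have fu x (e : R) : (u x <= e%:E)%E -> u x \is a fin_num.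
  by move=> ux; rewrite ge0_fin_numE// (le_lt_trans ux)// ltry.
split; first by apply: filterS (H 1 ltr01) => x; exact: fu.
apply/cvgrPdist_le => e e0; apply: filterS (H e e0) => x ux.
rewrite sub0r normrN ger0_norm ?fine_ge0//.
by rewrite -lee_fin fineK// (fu _ _ ux).
Qed.

End ereal_limits.

(** * Smallness of the commutator and the multiplier estimate *)

Section multiplier.
Variable R : realType.
Implicit Types (f g m : R -> R[i]) (t x : R).
Local Notation mu := (@lebesgue_measure R).

(** For fixed [c] the factor of the cosine is built from good families, so the Riemann-Lebesgue
    threshold does not depend on [t]. It does depend on [c]. *)
Lemma regularized_commutator_small m f (c e : R) : CT m -> CT f ->
  0 < c -> 0 < e ->
  exists N0 : nat, forall N t, (N0 <= N)%N ->
    cmod (cintegral `[t - pi, t + pi] (fun x =>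
      ((2 * pi)^-1)%:C%C * ((m x - m t) * f x) * (regularizer c (t - x))%:C%C *
      (cos (N%:R * (t - x)))%:C%C)) <= e.
Proof.
move=> Cm Cf c0 e0; have Cr := @CT_regularizer R c c0.
have [mc mp] := (CT_ccont m).1 Cm; have [fc fp] := (CT_ccont f).1 Cf.
have [rc rp] := (CT_ccont _).1 Cr.
have Ck : CT (fun _ : R => ((2 * pi)^-1)%:C%C : R[i]).
  by apply/CT_ccont; split => //; exact: ccont_cst.
have [_ eH] := good_familyM (good_familyM (good_family_CT Ck)
  (good_familyM (good_familyB (good_family_CT Cm) (good_family_cst Cm))
                (good_family_CT Cf))) (good_family_reflect Cr).
have Hc t : ccont (fun x =>
    ((2 * pi)^-1)%:C%C * ((m x - m t) * f x) * (regularizer c (t - x))%:C%C).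
  exact: (ccontM (ccontM (ccont_cst _) (ccontM (ccontB mc (ccont_cst _)) fc))
    (ccont_comp rc (@continuous_reflect R t))).
have Hp t x : ((2 * pi)^-1)%:C%C * ((m (x + 2 * pi) - m t) * f (x + 2 * pi)) *
    (regularizer c (t - (x + 2 * pi)))%:C%C =
    ((2 * pi)^-1)%:C%C * ((m x - m t) * f x) * (regularizer c (t - x))%:C%C.
  by rewrite mp fp; congr (_ * _); rewrite opprD addrA -[LHS]rp subrK.
exact: uniform_Riemann_Lebesgue Hc Hp eH e0.
Qed.

(** At distance at most [e] from [t], the factor involving [c] is at most 1 and the Dini quotient
    remains. Farther away, the constant multiplies the bound of [regularizer_far_le], the bound
    [K * (2 * M / e)] of the remaining integrand and the length [2 * pi] of the window. *)
Lemma remainder_le m f N t (c e M K : R) : CT m -> CT f ->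
  0 < c -> 0 < e -> 0 < K -> (forall x, cmod (m x) <= M) ->
  (forall x, cmod (f x) <= K) ->
  ((cmod (cintegral `[t - pi, t + pi] (fun x =>
      (c * regularizer c (t - x))%:C%C *
      (((2 * pi)^-1)%:C%C * ((m x - m t) * f x) * (dirichlet N (t - x))%:C%C))))%:E
   <= K%:E * dini_sup m e +
      (c * (2 * pi ^+ 2 / e ^+ 2) * (K * (2 * M / e)) * (2 * pi))%:E)%E.
Proof.
move=> Cm Cf c0 e0 K0 mM fK; have Cr := @CT_regularizer R c c0.
have [mc mp] := (CT_ccont m).1 Cm; have [fc fp] := (CT_ccont f).1 Cf.
have [rc rp] := (CT_ccont _).1 Cr.
have p0 := @pi_gt0 R.
have M0 : 0 <= M by apply: le_trans (mM 0); exact: cmod_ge0.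
set C0 := c * _ * _.
have C00 : 0 <= C0.
  have c0' := ltW c0; have e0' := ltW e0; have K0' := ltW K0.
  have p0' := ltW p0.
  apply: mulr_ge0.
    apply: mulr_ge0 => //; apply: divr_ge0; last exact: exprn_ge0.
    by apply: mulr_ge0 => //; exact: exprn_ge0.
  by apply: mulr_ge0 => //; apply: divr_ge0 => //; exact: mulr_ge0.
pose A := `[(t - e)%R, (t + e)%R]%classic.
pose gd x := (cmod (m t - m x) / `|t - x|)%:E.
have gd0 x : (0 <= gd x)%E by rewrite lee_fin divr_ge0 ?cmod_ge0.
have gdA0 x : (0 <= (gd \_ A) x)%E by rewrite erestrict_ge0.
have mgd (D : set R) : measurable_fun D gd by exact: measurable_dini.
have mgA (D : set R) : measurable_fun D (gd \_ A).
  apply: measurable_funS (@measurableT _ R) _ _ => //.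
  apply/(measurable_restrictT _ _).1; last exact: mgd.
  exact: measurable_itv.
have mKgA (D : set R) : measurable_fun D (fun x => K%:E * (gd \_ A) x)%E.
  by apply: measurable_funeM.
(* One majorant serves on the whole window: the Dini quotient restricted to [A], plus the far
   constant everywhere. This avoids splitting the integral and comparing [e] with [pi]. *)
apply: (@le_trans _ _ (\int[mu]_(x in `[(t - pi)%R, (t + pi)%R])
    (K%:E * (gd \_ A) x + C0%:E))%E).
  apply: cmod_cintegral_le.
  - apply: (ccontM _ (ccontM (ccontM (ccont_cst _) (ccontM (ccontB mc (ccont_cst _)) fc))
      (ccont_dirichlet N t))).
    apply: ccontR => x; apply: cvgM; first exact: cvg_cst.
    exact: (continuous_Re (ccont_comp rc (@continuous_reflect R t))).
  - by apply: emeasurable_funD => //; exact: measurable_cst.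
  - move=> x; rewrite in_itv/= -ler_distlC => tx.
    have r0 : 0 <= c * regularizer c (t - x).
      by rewrite mulr_ge0 ?ltW// invr_gt0 regularizer_den_gt0.
    have I1 := @commutator_integrand_le R m f N t x K (ltW K0) (fK x) tx.
    rewrite cmodM cmodR ger0_norm//.
    rewrite patchE; case: ifPn => [xA|xA].
      rewrite -EFinM -EFinD lee_fin ler_wpDr//.
      apply: le_trans I1; rewrite ler_piMl ?cmod_ge0//.
      exact: regularizer_near_le.
    rewrite mule0 add0e lee_fin.
    have {xA} ex : e < `|t - x|.
      rewrite ltNge; apply: contra xA => xA; rewrite inE /A /=.
      by rewrite in_itv/= -ler_distlC.
    apply: ler_pM => //; first exact: cmod_ge0.
      exact: regularizer_far_le.
    apply: (le_trans I1); rewrite ler_pM2l//.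
    apply: ler_pM; rewrite ?cmod_ge0 ?invr_ge0//.
      by rewrite (le_trans (ler_cmodD _ _))// cmodN mulr_natl mulr2n lerD.
    by rewrite lef_pV2 ?posrE ?(lt_trans e0 ex)// ltW.
rewrite ge0_integralD//; last 2 first.
- by move=> x _; rewrite mule_ge0// lee_fin ltW.
- exact: mKgA.
apply: leeD; last first.
  rewrite integral_cst// [X in (_ * X)%E]lebesgue_measure_itv/= lte_fin.
  have -> : t - pi < t + pi by rewrite ltrD2l; move: p0; lra.
  rewrite -EFinD -EFinM lee_fin.
  by rewrite (_ : t + pi - (t - pi) = 2 * pi) // mulr_natl mulr2n; ring.
rewrite ge0_integralZl_EFin//; last 2 first.
- exact: mgA.
- exact: ltW.
rewrite lee_wpmul2l ?lee_fin ?(ltW K0)// -integral_mkcondr.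
apply: (@le_trans _ _ (\int[mu]_(x in A) gd x)%E).
  apply: ge0_subset_integral => //; last exact: mgd.
    by apply: measurableI; exact: measurable_itv.
  exact: measurable_itv.
rewrite /A -dini_domainE.
by apply: ereal_sup_ubound; exists t.
Qed.

Lemma commutatorE m f N t (c : R) : CT m -> CT f -> 0 < c ->
  let H n := cintegral `[t - pi, t + pi] (fun x =>
      ((2 * pi)^-1)%:C%C * ((m x - m t) * f x) * (regularizer c (t - x))%:C%C *
      (cos (n%:R * (t - x)))%:C%C) in
  commutator m f N t = H N - H N.+1 +
    cintegral `[t - pi, t + pi] (fun x =>
      (c * regularizer c (t - x))%:C%C *
      (((2 * pi)^-1)%:C%C * ((m x - m t) * f x) * (dirichlet N (t - x))%:C%C)).
Proof.
move=> Cm Cf c0 H; have Cr := @CT_regularizer R c c0.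
have [mc mp] := (CT_ccont m).1 Cm; have [fc fp] := (CT_ccont f).1 Cf.
have [rc rp] := (CT_ccont _).1 Cr.
have rtc := ccont_comp rc (@continuous_reflect R t).
have kc := ccontM (ccont_cst (((2 * pi)^-1)%:C%C : R[i]))
  (ccontM (ccontB mc (ccont_cst (m t))) fc).
have ccos n : ccont (fun x : R => (cos (n%:R * (t - x)))%:C%C).
  apply: ccontR => x; apply: (@continuous_comp _ _ _
    (fun x => n%:R * (t - x)) (@cos R)); last exact: continuous_cos.
  by apply: cvgM; [exact: cvg_cst|exact: continuous_reflect].
have Hc n := ccontM (ccontM kc rtc) (ccos n).
have crc : ccont (fun x => (c * regularizer c (t - x))%:C%C).
  apply: ccontR => x; apply: cvgM; first exact: cvg_cst.
  exact: (continuous_Re rtc).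
have dc := ccontM kc (ccont_dirichlet N t).
rewrite /H -(cintegralB _ _ (Hc N) (Hc N.+1)).
rewrite -(cintegralD _ _ (ccontB (Hc N) (Hc N.+1)) (ccontM crc dc)).
apply: eq_cintegral => x _.
rewrite {1}(regularizer_split N (t - x) c0).
by rewrite rmorphD !rmorphM rmorphB /=; ring.
Qed.

Lemma commutator_small m f (e : R) : CT m -> CT f ->
  dini_sup m d @[d --> 0^'+] --> 0%E -> 0 < e ->
  exists N0 : nat, forall N t, (N0 <= N)%N -> cmod (commutator m f N t) <= e.
Proof.
move=> Cm Cf dm e0; have p0 := @pi_gt0 R.
have [M M0 mM] := CT_bounded Cm; have [K K0 fK] := CT_bounded Cf.
have e4 : 0 < e / 4 by rewrite divr_gt0.
(* The budget [e] is shared equally by the near part, the far part and the two cosine integrals. The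
   radius [d] is fixed first, then [c], and finally the rank. *)
have [d d0 dd] : exists2 d : R, 0 < d & (dini_sup m d <= (e / 4 / K)%:E)%E.
  have [d [d0 dd]] := filter_ex (filterI (nbhs_right_gt (0 : R))
    (ereal_cvg0_le dm (divr_gt0 e4 K0))).
  by exists d.
(* The far term of [remainder_le] is [c * B]; the choice of [c] below makes it equal to [e / 4]. *)
pose B := 2 * pi ^+ 2 / d ^+ 2 * (K * (2 * M / d)) * (2 * pi).
have B0 : 0 < B.
  apply: mulr_gt0; last exact: mulr_gt0.
  apply: mulr_gt0.
    by apply: divr_gt0; [apply: mulr_gt0 => //|]; exact: exprn_gt0.
  by apply: mulr_gt0 => //; apply: divr_gt0 => //; exact: mulr_gt0.
pose c := e / 4 / B.
have c0 : 0 < c by rewrite divr_gt0.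
have [N0 H] := regularized_commutator_small Cm Cf c0 e4.
exists N0 => N t N0N; rewrite (@commutatorE _ _ _ _ c)//.
have H1 := H N t N0N; have H2 := H N.+1 t (leqW N0N).
have H3 : cmod (cintegral `[t - pi, t + pi] (fun x =>
      (c * regularizer c (t - x))%:C%C *
      (((2 * pi)^-1)%:C%C * ((m x - m t) * f x) * (dirichlet N (t - x))%:C%C)))
    <= e / 4 + e / 4.
  rewrite -lee_fin (le_trans (remainder_le N t Cm Cf c0 d0 K0 mM fK))//.
  rewrite EFinD leeD//.
    rewrite (_ : e / 4 = K * (e / 4 / K)); last first.
      by rewrite [RHS]mulrC divfK// gt_eqF.
    by rewrite EFinM lee_wpmul2l// lee_fin ltW.
  rewrite lee_fin -2!mulrA [c * _](_ : _ = c * B); last first.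
    by rewrite /B !mulrA.
  by rewrite /c divfK// gt_eqF.
rewrite (le_trans (ler_cmodD _ _))// (_ : e = e / 4 + e / 4 + (e / 4 + e / 4)).
  rewrite lerD// (le_trans (ler_cmodD _ _))// cmodN lerD//.
by field.
Qed.

Lemma normCT_le f (K : R) : (normCT f <= K%:E)%E <-> forall t, cmod (f t) <= K.
Proof.
split=> [H t|H].
  by rewrite -lee_fin (le_trans _ H)//; apply: ereal_sup_ubound; exists t.
by apply: ge_ereal_sup => _ [t _ <-]; rewrite lee_fin.
Qed.

Lemma normCT_ge0 f : (0 <= normCT f)%E.
Proof.
apply: (@le_trans _ _ (cmod (f 0))%:E); first by rewrite lee_fin cmod_ge0.
by apply: ereal_sup_ubound; exists 0.
Qed.

(** Each value of [f] is a limit of values of its partial sums, all bounded by the norm of [f] in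
    $U(\mathbb T)$. *)
Lemma UT_le_normUT f : UT f -> (normCT f <= normUT f)%E.
Proof.
move=> [_ fU].
apply: ge_ereal_sup => _ [t _ <-]; apply/lee_addgt0Pr => e e0.
have [N HN] := filter_ex (ereal_cvg0_le fU e0).
have {}HN := (normCT_le _ _).1 HN t.
rewrite -[f t](subrK (fourier_sum N f t)).
apply: (@le_trans _ _ ((cmod (fourier_sum N f t))%:E + e%:E)%E).
  by rewrite -EFinD lee_fin (le_trans (ler_cmodD _ _))// addrC lerD2l.
rewrite leeD2r// (@le_trans _ _ (normCT (fourier_sum N f)))//.
  by apply: ereal_sup_ubound; exists t.
by apply: ereal_sup_ubound; exists N.
Qed.

Lemma UT_mul m f : CT m -> dini_sup m d @[d --> 0^'+] --> 0%E ->
  UT f -> UT (fun t => m t * f t).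
Proof.
move=> Cm dm [Cf fU]; split; first exact: CT_mul.
have [M M0 mM] := CT_bounded Cm.
apply: ereal_cvg0 => [N|e e0]; first exact: normCT_ge0.
have e2 : 0 < e / 2 by rewrite divr_gt0.
have [N0 H] := commutator_small Cm Cf dm e2.
have HU := ereal_cvg0_le fU (divr_gt0 e2 M0).
near=> N; apply/normCT_le => t.
rewrite fourier_sum_mul//.
(* The first term is uniformly small since [f] is in $U(\mathbb T)$ and [m] is bounded, the second
   by [commutator_small]. *)
rewrite (_ : _ - _ = m t * (f t - fourier_sum N f t) - commutator m f N t).
  rewrite (le_trans (ler_cmodD _ _))// cmodN [leRHS]splitr lerD//.
    rewrite cmodM (_ : e / 2 = M * (e / 2 / M)).
      apply: ler_pM; rewrite ?cmod_ge0//.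
      have : (normCT (fun t => f t - fourier_sum N f t)%R <= (e / 2 / M)%:E)%E.
        by near: N; exact: HU.
      by move=> /normCT_le/(_ t).
    by rewrite [RHS]mulrC divfK// gt_eqF.
  by apply: H; near: N; exact: nbhs_infty_ge.
by ring.
Unshelve. all: by end_near. Qed.

(** The norm bound enters twice: it bounds the partial sums multiplied by [m t], and through
    [UT_le_normUT] it bounds [f] itself, which gives the commutator estimate with [K = 1]. *)
Lemma normUT_mul_le m f : CT m -> UT f -> (normUT f <= 1)%E ->
  (normUT (fun t => m t * f t)%R <= normCT m + dini_sup m pi)%E.
Proof.
move=> Cm Uf nf.
have f1 : forall t, cmod (f t) <= 1.
  by apply/normCT_le; rewrite (le_trans (UT_le_normUT Uf)).
apply: ge_ereal_sup => _ [N _ <-]; apply: ge_ereal_sup => _ [t _ <-].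
rewrite fourier_sum_mul//; last by have [] := Uf.
apply: (@le_trans _ _ ((cmod (m t * fourier_sum N f t)%R)%:E +
    (cmod (commutator m f N t))%:E)%E).
  by rewrite -EFinD lee_fin ler_cmodD.
apply: leeD.
  apply: (@le_trans _ _ (cmod (m t))%:E).
    rewrite lee_fin cmodM ler_piMr ?cmod_ge0//.
    have : (normCT (fourier_sum N f) <= 1)%E.
      by apply: le_trans nf; apply: ereal_sup_ubound; exists N.
    by move=> /normCT_le.
  by apply: ereal_sup_ubound; exists t.
rewrite -[leRHS]mul1e; apply: commutator_le => //.
by have [] := Uf.
Qed.

End multiplier.

Theorem theorem1 (R : realType) (m : R -> R[i])
    (m_cont : CT m)
    (m_dini : dini_sup m e @[e --> 0^'+] --> 0%E) :
  MUT m /\ (normMUT m <= normCT m + dini_sup m pi)%E.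
Proof.
split.
  by split; [exact: m_cont|move=> f Uf; exact: (UT_mul m_cont m_dini Uf)].
by apply: ge_ereal_sup => _ [f [Uf nf] <-]; exact: normUT_mul_le.
Qed.
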